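(* Let $\{f_l:\mathbb{R}^{p_l}\times\mathbb{R}^{d_{l-1}\times N}\to\mathbb{R}^{d_l\times N}\}_{l=1}^L$ be continuously differentiable maps, and let $\{S_l\subset\mathbb{R}^{p_l}\}_{l=1}^L$ be subsets of the parameter spaces. Suppose that for each $l$ and each bounded set $B_l\subset\mathbb{R}^{d_{l-1}\times N}$, the maps $f_l$, $Df_l$ and $Jf_l$ are all bounded and Lipschitz on $S_l\times B_l$. Let $p=\sum_{l=1}^Lp_l$. Then for any data matrix $X\in\mathbb{R}^{d_0\times N}$, the derivative $DF$ of the associated parameter-function map $F:\mathbb{R}^p\to\mathbb{R}^{d_L\times N}$ is bounded and Lipschitz on $S:=\prod_{l=1}^LS_l\subset\mathbb{R}^p$.
   Context: $Df_l$ and $Jf_l$ denote the derivatives of $f_l$ with respect to the parameter variable in $\mathbb{R}^{p_l}$ and the input variable in $\mathbb{R}^{d_{l-1}\times N}$ respectively. The parameter-function map associated to $\{f_l\}_{l=1}^L$ and $X$ is $F(\vec\theta)=f_L(\theta_L)\circ\cdots\circ f_1(\theta_1)(X)$ for $\vec\theta=(\theta_1,\dots,\theta_L)\in\mathbb{R}^p$, where $f_l(\theta_l)$ is the map $Z\mapsto f_l(\theta_l,Z)$. *)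

(* Defs.v *)
From HB Require Import structures.
From mathcomp Require Import all_boot all_order all_algebra.
From mathcomp Require Import all_classical all_reals all_analysis.

Set Implicit Arguments.
Unset Strict Implicit.
Unset Printing Implicit Defensive.

Import Order.TTheory GRing.Theory Num.Theory.
Import numFieldNormedType.Exports.

Local Open Scope classical_set_scope.
Local Open Scope ring_scope.

(* Matrices and pairs carry the max norm of the library, which is equivalent to
   the Euclidean one; boundedness, Lipschitz continuity and differentiability
   are the same for both. *)

(* [sup] is 0 on sets that are unbounded above, so this is the operator norm
   only for continuous linear [g]. *)
Definition op_norm (R : realType) (V W : normedModType R) (g : V -> W) : R :=
  sup [set `|g v| | v in [set v : V | `|v| <= 1]].

Definition continuously_differentiable (R : realType) (V W : normedModType R)
    (f : V -> W) : Prop :=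
  (forall x : V, differentiable f x) /\
  (forall x : V, op_norm ('d f y \- 'd f x) @[y --> x] --> (0 : R)).

Definition bounded_lipschitz (R : realType) (V W : normedModType R)
    (f : V -> W) (A : set V) : Prop :=
  [bounded f x | x in A] /\ [lipschitz f x | x in A].

(* The same for an operator-valued map [D], with respect to the operator
   norm. *)
Definition op_bounded_lipschitz (R : realType) (U V W : normedModType R)
    (D : U -> V -> W) (A : set U) : Prop :=
  (exists M : R, forall x, A x -> op_norm (D x) <= M) /\
  (exists k : R, forall x y, A x -> A y ->
     op_norm (D x \- D y) <= k * `|x - y|).

Section PartialDerivatives.
Context {R : realType} {P V W : normedModType R}.

Definition param_diff (f : P * V -> W) (z : P * V) : P -> W :=
  'd (fun t : P => f (t, z.2)) (z.1).

Definition input_diff (f : P * V -> W) (z : P * V) : V -> W :=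
  'd (fun Z : V => f (z.1, Z)) (z.2).

End PartialDerivatives.

Fixpoint compose_layers (T : nat -> Type) (L : nat) :
    (forall l : 'I_L, T l -> T l.+1) -> T 0%N -> T L :=
  match L with
  | 0%N => fun _ X => X
  | L'.+1 => fun g X =>
      g ord_max
        (@compose_layers T L' (fun l => g (widen_ord (leqnSn L') l)) X)
  end.

(* Layers are numbered from 0, so layer [l] maps widths [d l] to [d l.+1]; only
   [d 0, ..., d L] matter.  The [l]-th parameter block [theta_l] of [theta] is
   [submxrow theta l]. *)
Definition param_fun_map (R : realType) (L N : nat) (d : nat -> nat)
    (p : 'I_L -> nat)
    (f : forall l : 'I_L,
       'rV[R]_(p l) * 'M[R]_(d l, N) -> 'M[R]_(d l.+1, N))
    (X : 'M[R]_(d 0%N, N))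
    (theta : 'rV[R]_(\sum_(l < L) p l)) : 'M[R]_(d L, N) :=
  @compose_layers (fun l => 'M[R]_(d l, N)) L
    (fun l Z => f l (submxrow theta l, Z)) X.

Definition param_product (R : realType) (L : nat) (p : 'I_L -> nat)
    (S : forall l : 'I_L, set 'rV[R]_(p l)) :
    set 'rV[R]_(\sum_(l < L) p l) :=
  [set theta | forall l : 'I_L, S l (submxrow theta l)].

(* Main.v *)
(* Peel off the last layer: the map is u |-> f (pi u, F u), where pi picks the
   last parameter block and F is the composition of the previous layers.  If F
   and DF are bounded and Lipschitz on A, then B := F(A) is a bounded set of
   inputs, so f, Df and Jf are bounded and Lipschitz on S x B, hence along
   u |-> (pi u, F u), and the chain rule
     h |-> Df(pi u, F u) (pi h) + Jf(pi u, F u) (DF(u) h)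
   gives the same properties after the last layer.  The Lipschitz bound on F is
   carried through the induction, not deduced from the bound on DF, since A need
   not be convex. *)

Require Import Defs.
From HB Require Import structures.
From mathcomp Require Import all_boot all_order all_algebra.
From mathcomp Require Import all_classical all_reals all_analysis.
From mathcomp Require Import ring lra.

Set Implicit Arguments.
Unset Strict Implicit.
Unset Printing Implicit Defensive.

Import Order.TTheory GRing.Theory Num.Theory.
Import numFieldNormedType.Exports.

Local Open Scope classical_set_scope.
Local Open Scope ring_scope.

(** * Operator norms and uniform constants *)

Lemma op_norm_le (R : realType) (V W : normedModType R) (g : V -> W) (M : R) :
  (forall v, `|v| <= 1 -> `|g v| <= M) -> op_norm g <= M.
Proof.
move=> gM; apply: ge_sup; last by move=> _ [v v1 <-]; exact: gM.
by exists `|g 0|, 0 => //=; rewrite normr0.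
Qed.

(** Rescale [v] to the unit sphere. Continuity bounds the values on the unit ball, so [sup] is a
    true supremum there and not its default value 0. *)
Lemma le_op_norm (R : realType) (V W : normedModType R) (g : {linear V -> W})
    (v : V) : continuous g -> `|g v| <= op_norm g * `|v|.
Proof.
move=> cg.
have [M M0 gM] : exists2 M, M > 0 & forall x, `|g x| <= M * `|x|.
  exact/pinfty_ex_gt0/linear_boundedP/linear_bounded_continuous.
have [->|v0] := eqVneq v 0; first by rewrite linear0 !normr0 mulr0.
have nv0 : 0 < `|v| by rewrite normr_gt0.
rewrite -ler_pdivrMr //; apply: ub_le_sup.
  exists M => _ [w /= w1 <-].
  by rewrite (le_trans (gM w))// ler_piMr// ltW.
exists (`|v|^-1 *: v) => /=.
  by rewrite normrZ normfV normr_id mulVf// normr_eq0.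
by rewrite linearZ normrZ normfV normr_id mulrC.
Qed.

(** Trades operator norms for estimates at each vector [h], which combine directly along the chain
    rule. Asking for all large [M] lets the constants of several maps be merged by intersecting
    filters. *)
Lemma op_bounded_lipschitz_near (R : realType) (U V W : normedModType R)
    (D : U -> {linear V -> W}) (A : set U) :
  (forall u, continuous (D u)) ->
  op_bounded_lipschitz (fun u => D u : V -> W) A ->
  \forall M \near +oo,
    (forall u, A u -> forall h, `|D u h| <= M * `|h|) /\
    (forall u v, A u -> A v -> forall h,
       `|D u h - D v h| <= M * `|u - v| * `|h|).
Proof.
move=> cD [[M DM] [k Dk]]; near=> K.
have MK : M <= K by near: K; apply: nbhs_pinfty_ge; rewrite num_real.
have kK : k <= K by near: K; apply: nbhs_pinfty_ge; rewrite num_real.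
split=> [u Au h|u v Au Av h].
  rewrite (le_trans (le_op_norm h (cD u)))// ler_wpM2r//.
  exact: le_trans (DM u Au) MK.
have cDB : continuous (D u \- D v) :=
  fun x => continuousB (cD u x) (cD v x).
rewrite (le_trans (@le_op_norm _ _ _ (D u \- D v : {linear V -> W}) h cDB))//.
rewrite ler_wpM2r// (le_trans (Dk _ _ Au Av))// ler_wpM2r//.
Unshelve. all: by end_near. Qed.

Lemma bounded_lipschitz_near (R : realType) (V W : normedModType R)
    (f : V -> W) (A : set V) :
  bounded_lipschitz f A ->
  \forall M \near +oo,
    (forall x, A x -> `|f x| <= M) /\
    (forall x y, A x -> A y -> `|f x - f y| <= M * `|x - y|).
Proof.
move=> [bf lf]; near=> K; split.
  by near: K.
move=> x y Ax Ay.
have : (K.-lipschitz_on f (globally (A `*` A))) by near: K.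
by move=> /(_ (x, y)); apply.
Unshelve. all: by end_near. Qed.

(** * Partial differentials as restrictions of the total one *)

Section PartialDifferentials.
Context {R : realType} {P V W : normedModType R}.
Context {f : P * V -> W} {z : P * V} (df : differentiable f z).

(** The composites below meet [f] at [(z.1, z.2)], which is not convertible to the variable [z]. *)
Let df' : differentiable f (z.1, z.2). Proof. by case: z df. Qed.

Let inl_diff : is_diff (z.1) (fun t : P => (t, z.2)) (fun h => (h, 0)).
Proof. exact: (@is_diff_pair _ _ _ _ id _ (cst (z.2))). Qed.

Let inr_diff : is_diff (z.2) (fun t : V => (z.1, t)) (fun h => (0, h)).
Proof. exact: (@is_diff_pair _ _ _ _ (cst (z.1)) _ id). Qed.

Lemma param_diffE (h : P) : param_diff f z h = 'd f z (h, 0).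
Proof.
rewrite /param_diff (_ : (fun t => _) = f \o (fun t => (t, z.2)))//.
by rewrite diff_comp// /comp diff_val -surjective_pairing.
Qed.

Lemma input_diffE (h : V) : input_diff f z h = 'd f z (0, h).
Proof.
rewrite /input_diff (_ : (fun t => _) = f \o (fun t => (z.1, t)))//.
by rewrite diff_comp// /comp diff_val -surjective_pairing.
Qed.

Lemma continuous_param_diff : continuous (param_diff f z).
Proof.
apply: diff_continuous.
by apply: (@differentiable_comp _ _ _ _ (fun t => (t, z.2)) f).
Qed.

Lemma continuous_input_diff : continuous (input_diff f z).
Proof.
apply: diff_continuous.
by apply: (@differentiable_comp _ _ _ _ (fun t => (z.1, t)) f).
Qed.

Lemma diff_partialE (h : P * V) :
  'd f z h = param_diff f z h.1 + input_diff f z h.2.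
Proof.
rewrite param_diffE input_diffE -linearD; congr ('d f z _).
by case: h => a b; congr (_, _) => /=; rewrite ?addr0 ?add0r.
Qed.

End PartialDifferentials.

(** * Induction over the layers *)

(** The induction invariant. One constant serves all four estimates, and those on the derivative are
    taken at each vector, so no supremum enters the induction. *)
Definition bounded_lipschitz_C1 (R : realType) (U V : normedModType R)
    (F : U -> V) (A : set U) (M : R) : Prop :=
  [/\ forall u, differentiable F u,
      forall u, A u -> `|F u| <= M,
      forall u v, A u -> A v -> `|F u - F v| <= M * `|u - v|,
      forall u, A u -> forall h, `|'d F u h| <= M * `|h|
    & forall u v, A u -> A v -> forall h,
        `|'d F u h - 'd F v h| <= M * `|u - v| * `|h|].

Lemma bounded_lipschitz_C1_layer (R : realType) (U P V W : normedModType R)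
    (f : P * V -> W) (S : set P) (pi : {linear U -> P}) (F : U -> V)
    (A : set U) (M : R) :
  (forall z, differentiable f z) ->
  (forall B : set V, bounded_set B ->
     [/\ bounded_lipschitz f (S `*` B),
         op_bounded_lipschitz (param_diff f) (S `*` B)
       & op_bounded_lipschitz (input_diff f) (S `*` B)]) ->
  (forall u, `|pi u| <= `|u|) -> (forall u, A u -> S (pi u)) ->
  0 <= M -> bounded_lipschitz_C1 F A M ->
  exists2 M' : R, 0 <= M' & bounded_lipschitz_C1 (fun u => f (pi u, F u)) A M'.
Proof.
move=> df fS pi1 AS M0 [dF FM FL dFM dFL].
have cpi : continuous pi.
  apply/linear_bounded_continuous/linear_boundedP; near=> r => x.
  by rewrite (le_trans (pi1 x))// ler_peMl.
have [fB DB JB] : [/\ bounded_lipschitz f (S `*` F @` A),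
    op_bounded_lipschitz (param_diff f) (S `*` F @` A)
    & op_bounded_lipschitz (input_diff f) (S `*` F @` A)].
  apply: fS; rewrite /= /bounded_near; near=> r => _ [u Au <-] /=.
  by rewrite (le_trans (FM _ Au)).
have DK := op_bounded_lipschitz_near (fun z => continuous_param_diff (df z)) DB.
have JK := op_bounded_lipschitz_near (fun z => continuous_input_diff (df z)) JB.
(* A single positive [K] bounds [f] and both partial derivatives, and is a Lipschitz constant for
   all three. *)
have [K K0 [[fK fL] [{DK}[DK DL] {JK}[JK JL]]]] :=
  pinfty_ex_gt0 (filterI (bounded_lipschitz_near fB) (filterI DK JK)).
pose z u := (pi u, F u).
have zA u : A u -> (S `*` F @` A) (z u).
  by move=> Au; split; [exact: AS|exists u].
(* Under the max norm on pairs, [M + 1] dominates both 1, from [pi], and [M], from [F]. *)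
have zL u v : A u -> A v -> `|z u - z v| <= (M + 1) * `|u - v|.
  move=> Au Av; rewrite prod_normE ge_max /= -linearB; apply/andP; split.
    by rewrite (le_trans (pi1 _))// ler_peMl// lerDr.
  by rewrite (le_trans (FL _ _ Au Av))// ler_wpM2r// lerDl.
have dpi u : differentiable pi u by exact: linear_differentiable.
have dz u : differentiable z u by exact: differentiable_pair.
have dGE u h : 'd (fun u => f (pi u, F u)) u h =
    param_diff f (z u) (pi h) + input_diff f (z u) ('d F u h).
  rewrite (diff_comp (dz u) (df (z u)))/= diff_partialE//.
  by rewrite (diff_pair (dpi u) (dF u))/= diff_lin.
have K0' := ltW K0.
(* The largest demand comes from the Lipschitz bound on the derivative, which needs
   [K * ((M + 1) * (M + 1) + M)]; the other three need [K] or [K * (M + 1)]. *)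
exists (K * ((M + 1) * (M + 2))).
  by rewrite mulr_ge0// mulr_ge0// addr_ge0.
split.
- by move=> u; exact: differentiable_comp (dz u) (df (z u)).
- by move=> u Au; rewrite (le_trans (fK _ (zA _ Au)))//; nra.
- move=> u v Au Av; rewrite (le_trans (fL _ _ (zA _ Au) (zA _ Av)))//.
  rewrite -mulrA ler_wpM2l// (le_trans (zL _ _ Au Av))// ler_wpM2r//.
  nra.
- move=> u Au h; rewrite dGE (le_trans (ler_normD _ _))//.
  have Dh := DK _ (zA _ Au) (pi h).
  have Jh := JK _ (zA _ Au) ('d F u h).
  rewrite (le_trans (lerD Dh Jh))// -mulrDr -mulrA ler_wpM2l//.
  rewrite (le_trans (lerD (pi1 h) (dFM _ Au h)))//.
  have := normr_ge0 h; nra.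
- move=> u v Au Av h; rewrite !dGE.
  (* Inserting [input_diff f (z v) ('d F u h)] separates the change of the base point of the partial
     derivatives from the change of ['d F]. *)
  have -> : param_diff f (z u) (pi h) + input_diff f (z u) ('d F u h)
      - (param_diff f (z v) (pi h) + input_diff f (z v) ('d F v h))
    = (param_diff f (z u) (pi h) - param_diff f (z v) (pi h))
      + (input_diff f (z u) ('d F u h) - input_diff f (z v) ('d F u h))
      + input_diff f (z v) ('d F u h - 'd F v h).
    by rewrite /input_diff linearB -[RHS]addrA subrKA opprD addrACA.
  rewrite (le_trans (ler_normD _ _))//.
  rewrite (le_trans (lerD (ler_normD _ _) (lexx _)))//.
  have Dh := DL _ _ (zA _ Au) (zA _ Av) (pi h).
  have Jh := JL _ _ (zA _ Au) (zA _ Av) ('d F u h).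
  have Jd := JK _ (zA _ Av) ('d F u h - 'd F v h).
  rewrite (le_trans (lerD (lerD Dh Jh) Jd))//.
  have Kz : K * `|z u - z v| <= K * ((M + 1) * `|u - v|).
    by rewrite ler_wpM2l// zL.
  have Kz0 : 0 <= K * `|z u - z v| by rewrite mulr_ge0.
  have Dle := ler_pM Kz0 (normr_ge0 _) Kz (pi1 h).
  have Jle := ler_pM Kz0 (normr_ge0 _) Kz (dFM _ Au h).
  have dle : K * `|'d F u h - 'd F v h| <= K * (M * `|u - v| * `|h|).
    by rewrite ler_wpM2l// dFL.
  rewrite (le_trans (lerD (lerD Dle Jle) dle))//.
  have uvh : 0 <= K * `|u - v| * `|h| by rewrite !mulr_ge0.
  rewrite [leLHS](_ : _ =
    (K * `|u - v| * `|h|) * ((M + 1) * (M + 1) + M)); last by ring.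
  rewrite [leRHS](_ : _ =
    (K * `|u - v| * `|h|) * ((M + 1) * (M + 2))); last by ring.
  by rewrite ler_wpM2l//; nra.
Unshelve. all: by end_near. Qed.

(** [U] and [A] stay fixed while [L] varies: each layer reads its parameters off the same [u]
    through [pi l], so dropping the last layer only restricts the families along [widen_ord]. *)
Lemma compose_layers_C1 (R : realType) (U : normedModType R)
    (A : set U) (L : nat) : forall (V : nat -> normedModType R)
    (P : 'I_L -> normedModType R)
    (f : forall l : 'I_L, P l * V l -> V l.+1)
    (S : forall l : 'I_L, set (P l)) (pi : forall l : 'I_L, {linear U -> P l})
    (X : V 0%N),
  (forall (l : 'I_L) z, differentiable (f l) z) ->
  (forall (l : 'I_L) (B : set (V l)), bounded_set B ->
     [/\ bounded_lipschitz (f l) (S l `*` B),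
         op_bounded_lipschitz (param_diff (f l)) (S l `*` B)
       & op_bounded_lipschitz (input_diff (f l)) (S l `*` B)]) ->
  (forall (l : 'I_L) u, `|pi l u| <= `|u|) ->
  (forall (l : 'I_L) u, A u -> S l (pi l u)) ->
  exists2 M : R, 0 <= M & bounded_lipschitz_C1 (fun u =>
    @compose_layers (fun l => V l) L (fun l Z => f l (pi l u, Z)) X) A M.
Proof.
elim: L => [|L IH] V P f S pi X df fS pi1 AS.
  (* With no layers the map is constantly [X], and its derivative vanishes. *)
  exists `|X| => //=; split => //.
  - by move=> u v _ _; rewrite subrr normr0 mulr_ge0.
  - by move=> u _ h; rewrite (diff_cst X u) normr0 mulr_ge0.
  - by move=> u v _ _ h; rewrite !(diff_cst X) subrr normr0 !mulr_ge0.
have [M M0 HM] := let w := widen_ord (leqnSn L) in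
  IH V _ (fun l => f (w l)) (fun l => S (w l)) (fun l => pi (w l)) X
    (fun l => df (w l)) (fun l => fS (w l)) (fun l => pi1 (w l))
    (fun l => AS (w l)).
exact: bounded_lipschitz_C1_layer (df ord_max) (fS ord_max) (pi1 _) (AS _)
  M0 HM.
Qed.

(** The entries of a block are among those of [A], and the norm is the largest absolute value of an
    entry. *)
Lemma norm_submxrow_le (R : realDomainType) (L m : nat) (p : 'I_L -> nat)
    (l : 'I_L) (A : 'M[R]_(m, \sum_(i < L) p i)) :
  mx_norm (submxrow A l) <= mx_norm A.
Proof.
(* A nonzero norm is attained at some entry; the zero case also covers empty blocks. *)
have [->|/mx_norm_neq0[[i j] ->]] := eqVneq (mx_norm (submxrow A l)) 0.
  by rewrite mx_normE.
rewrite mxE mx_normrE.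
by apply: (le_bigmax _ (fun ij => `|A ij.1 ij.2|) (i, _)).
Qed.

Theorem proposition4p3 (R : realType) (L N : nat) (d : nat -> nat)
  (p : 'I_L -> nat)
  (f : forall l : 'I_L, 'rV[R]_(p l) * 'M[R]_(d l, N) -> 'M[R]_(d l.+1, N))
  (S : forall l : 'I_L, set 'rV[R]_(p l))
  (hC1 : forall l : 'I_L, continuously_differentiable (f l))
  (hS : forall (l : 'I_L) (B : set 'M[R]_(d l, N)), bounded_set B ->
     [/\ bounded_lipschitz (f l) (S l `*` B),
         op_bounded_lipschitz (param_diff (f l)) (S l `*` B)
       & op_bounded_lipschitz (input_diff (f l)) (S l `*` B)])
  (X : 'M[R]_(d 0%N, N)) :
  (forall theta : 'rV[R]_(\sum_(l < L) p l),
     differentiable (param_fun_map f X) theta) /\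
  op_bounded_lipschitz
    (fun theta : 'rV[R]_(\sum_(l < L) p l) =>
       'd (param_fun_map f X) theta : _ -> _)
    (param_product S).
Proof.
(* The block projection [submxrow] is supplied as [colsub] along [tagnat.Rank], which carries the
   linear structure asked of [pi]. *)
have [M M0 [dF _ _ FM FL]] := @compose_layers_C1 R _ (param_product S) L
  (fun l => 'M[R]_(d l, N)) (fun l => 'rV[R]_(p l)) f S
  (fun l => colsub (@tagnat.Rank _ p l)) X
  (fun l => (hC1 l).1) hS (fun l => @norm_submxrow_le R L 1 p l)
  (fun l _ SA => SA l).
(* On the unit ball the factor [|h|] is at most 1, so the estimates at each vector become operator
   norm bounds. *)
split=> //; split; exists M.
  move=> u Au; apply: op_norm_le => h h1.
  by rewrite (le_trans (FM _ Au h))// ler_piMr.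
move=> u v Au Av; apply: op_norm_le => h h1.
by rewrite (le_trans (FL _ _ Au Av h))// ler_piMr// mulr_ge0.
Qed.
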